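(* Let $n\ge 1$ and let $f,g:\mathbb{C}^n\to\mathbb{C}$ be two polynomials. If $f$ and $g$ are bi-Lipschitz contact equivalent at infinity, then $\deg(f)=\deg(g)$.
   Context: $\|\cdot\|$ is the Euclidean norm (the modulus on $\mathbb{C}$), and $\deg$ is the total degree of a polynomial. A bi-Lipschitz homeomorphism is a bijection that is Lipschitz with Lipschitz inverse (for the distance induced by the Euclidean norm). Two polynomials $f,g:\mathbb{C}^n\to\mathbb{C}$ are bi-Lipschitz contact equivalent at infinity if there are compact subsets $K,\widetilde K\subset\mathbb{C}^n$, a constant $C>0$ and a bi-Lipschitz homeomorphism $\varphi:\mathbb{C}^n\setminus K\to\mathbb{C}^n\setminus\widetilde K$ such that $$\frac{1}{C}\|f(x)\|\leq\|g\circ\varphi(x)\|\leq C\|f(x)\|\quad\text{for all }x\in\mathbb{C}^n\setminus K.$$ *)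

(* Defs.v *)
From HB Require Import structures.
From mathcomp Require Import all_boot all_order all_algebra.
From mathcomp Require Import all_classical all_reals all_analysis.
From mathcomp Require Import complex.
(* The notations of mpoly clash with those of mathcomp-analysis. *)
From mathcomp Require mpoly.
Import (canonicals, coercions) mpoly.
Set Implicit Arguments.
Unset Strict Implicit.
Unset Printing Implicit Defensive.
Import Order.TTheory GRing.Theory Num.Theory.
Import numFieldNormedType.Exports.
Local Open Scope classical_set_scope.
Local Open Scope ring_scope.
Local Open Scope complex_scope.

(* ^o is what makes mathcomp-analysis find the topology of R[i]. *)
Notation Cn R n := ('rV[R[i]^o]_n).

Definition cmod (R : realType) (z : R[i]) : R := ComplexField.Normc.normc z.

(* The library's norm on row vectors is the sup norm, hence this definition. *)
Definition enorm (R : realType) (n : nat) (x : Cn R n) : R :=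
  Num.sqrt (\sum_(i < n) cmod (x ord0 i) ^+ 2).

Definition lipschitz_in (R : realType) (n : nat) (A : set (Cn R n))
    (phi : Cn R n -> Cn R n) : Prop :=
  exists L : R, forall x y : Cn R n, A x -> A y ->
    enorm (phi x - phi y) <= L * enorm (x - y).

(* Maps A -> B are represented by total functions whose values outside A are
   irrelevant; psi is the inverse B -> A of phi. *)
Definition bilipschitz_homeo (R : realType) (n : nat) (A B : set (Cn R n))
    (phi : Cn R n -> Cn R n) : Prop :=
  [/\ set_bij A B phi, lipschitz_in A phi &
      exists psi : Cn R n -> Cn R n,
        (forall x, A x -> psi (phi x) = x) /\ lipschitz_in B psi].

Definition peval (R : realType) (n : nat) (f : mpoly.mpoly n R[i])
    (x : Cn R n) : R[i] :=
  mpoly.meval (fun i : 'I_n => x ord0 i) f.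

Definition bilipschitz_contact_equiv_infty (R : realType) (n : nat)
    (f g : mpoly.mpoly n R[i]) : Prop :=
  exists (K K' : set (Cn R n)) (C : R) (phi : Cn R n -> Cn R n),
    [/\ compact K, compact K', 0 < C,
        bilipschitz_homeo (~` K) (~` K') phi &
        forall x : Cn R n, (~` K) x ->
          C^-1 * cmod (peval f x) <= cmod (peval g (phi x)) <=
          C * cmod (peval f x)].

(* msize p is 1 + deg p for p != 0 and msize 0 = 0; None is deg 0 = -oo. *)
Definition total_degree (R : realType) (n : nat) (p : mpoly.mpoly n R[i]) :
    option nat :=
  if mpoly.msize p is d.+1 then Some d else None.

(* Main.v *)
(* The degree is the growth rate at infinity: on a ray t v along which the
   leading form of f does not vanish, |f(t v)| grows like t^(deg f), whereas
   phi(t v) grows at most linearly because phi is Lipschitz, so that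
   |g(phi(t v))| = O(t^(deg g)). Hence |f| <= C |g o phi| outside a compact set
   gives deg f <= deg g, and the inverse of phi gives the other inequality. *)

Require Import Defs.
From mathcomp Require Import all_boot all_order all_algebra.
From mathcomp Require Import all_classical all_reals all_analysis.
From mathcomp Require Import complex.
From mathcomp Require mpoly.
Import (canonicals, coercions) mpoly.
Set Implicit Arguments.
Unset Strict Implicit.
Unset Printing Implicit Defensive.
Import Order.TTheory GRing.Theory Num.Theory.
Import numFieldNormedType.Exports.
Local Open Scope classical_set_scope.
Local Open Scope ring_scope.
Local Open Scope complex_scope.

(** * Points where a nonzero polynomial does not vanish *)

(** The naturals below [size p] are pairwise distinct in [F], and there is one too many of them for
    all to be roots. *)
Lemma poly_exists_nonroot (F : numDomainType) (p : {poly F}) :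
  p != 0 -> exists a, p.[a] != 0.
Proof.
move=> p0; apply: contrapT => /forallNP allroot.
pose rs := [seq i%:R : F | i <- iota 0 (size p)].
have : (size rs < size p)%N.
  apply: max_poly_roots => //.
    apply/allP => a _; apply/rootP/eqP.
    by have /negP := allroot a; rewrite negbK.
  by rewrite map_inj_uniq ?iota_uniq // => i j /eqP; rewrite eqr_nat => /eqP.
by rewrite size_map size_iota ltnn.
Qed.

(** Induction on the number of variables: [muni] makes [p] univariate in the last variable. A point
    where one of its coefficients does not vanish is extended by a nonroot of the specialised
    polynomial. *)
Lemma mpoly_exists_nonzero_eval (F : numDomainType) (n : nat)
    (p : mpoly.mpoly n F) : p != 0 -> exists v, mpoly.meval v p != 0.
Proof.
elim: n => [|n IH] in p *.
  move=> p0; exists (fun=> 0).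
  (* Without variables every monomial has degree 0, so [p] is constant. *)
  have : (mpoly.msize p <= 1)%N.
    rewrite mpoly.msizeE; elim/big_ind: _ => // [x y|m _].
      by rewrite geq_max => -> ->.
    by rewrite mpoly.mdegE big_ord0.
  move/mpoly.msize1_polyC => pE; rewrite pE mpoly.mevalC.
  by apply: contra p0 => /eqP c0; rewrite pE c0 mpoly.mpolyC0.
move=> p0.
(* A monomial is determined by its restriction [r m] and its last exponent, so only [m0] contributes
   to the coefficient extracted here. *)
have q0 : mpoly.muni p != 0.
  have m0p := mpoly.mlead_supp p0; set m0 := mpoly.mlead p in m0p.
  pose r (m : mpoly.multinom n.+1) : mpoly.multinom n :=
    mpoly.Multinom [tuple m (widen_ord (leqnSn n) i) | i < n].
  apply/eqP => /(congr1 (fun q : {poly mpoly.mpoly n F} =>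
    mpoly.mcoeff (r m0) q`_(m0 ord_max))).
  rewrite mpoly.muniE coef0 coef_sum raddf_sum /= mpoly.mcoeff0.
  rewrite (bigD1_seq m0) ?mpoly.msupp_uniq //= big1 ?addr0.
    rewrite coefZ coefXn eqxx mulr1 mpoly.mcoeffZ mpoly.mcoeffX.
    move/eqP; rewrite -/(r m0) eqxx mulr1.
    by apply/negP; rewrite -mpoly.mcoeff_msupp.
  move=> m mm0; rewrite coefZ coefXn.
  have [em|] := eqVneq (m0 ord_max) (m ord_max); last first.
    by rewrite mulr0 mpoly.mcoeff0.
  rewrite mulr1 mpoly.mcoeffZ mpoly.mcoeffX -/(r m).
  have [er|] := eqVneq (r m) (r m0); last by rewrite mulr0.
  case/eqP: mm0; apply/mpoly.mnmP => i.
  have [j ->|->] := unliftP ord_max i; last by [].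
  move/mpoly.mnmP: er => /(_ j); rewrite !mpoly.mnmE.
  by congr (_ = _); congr (_ _); apply/val_inj; rewrite /= /bump leqNgt ltn_ord.
have [k qk0] : exists k, (mpoly.muni p)`_k != 0.
  by exists (size (mpoly.muni p)).-1; rewrite -lead_coefE lead_coef_eq0.
have [v vq] := IH _ qk0.
have [a] : exists a, (map_poly (mpoly.meval v) (mpoly.muni p)).[a] != 0.
  apply: poly_exists_nonroot; apply: contra vq => /eqP.
  by move=> /(congr1 (fun q : {poly F} => q`_k)); rewrite coef_map coef0 => ->.
(* The point [v] with [a] appended as last coordinate. *)
move=> pa; exists (fun i => oapp v a (unlift ord_max i)).
apply: contra pa => /eqP <-; apply/eqP.
rewrite mpoly.muniE rmorph_sum horner_sum mpoly.mevalE; apply: eq_bigr => m _.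
rewrite /= map_polyZ map_polyXn hornerZ hornerXn /=.
rewrite mpoly.mevalZ mpoly.mevalX -mulrA.
congr (_ * _); rewrite [RHS]big_ord_recr /= unlift_none; congr (_ * _).
apply: eq_bigr => j _; rewrite mpoly.mnmE.
rewrite (_ : widen_ord _ j = lift ord_max j) ?liftK //.
by apply/val_inj; rewrite /= /bump leqNgt ltn_ord.
Qed.

(** * The modulus on the complex numbers *)

Section Modulus.
Variable R : realType.
Implicit Types z w : R[i].

Lemma cmod_ge0 z : 0 <= cmod z.
Proof. by case: z => a b; exact: sqrtr_ge0. Qed.

Lemma cmod0 : cmod (0 : R[i]) = 0.
Proof. exact: ComplexField.Normc.normc0. Qed.

Lemma cmod_eq0 z : (cmod z == 0) = (z == 0).
Proof.
apply/eqP/eqP => [|->]; [exact: ComplexField.Normc.eq0_normc | exact: cmod0].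
Qed.

Lemma cmodM z w : cmod (z * w) = cmod z * cmod w.
Proof. exact: ComplexField.Normc.normcM. Qed.

Lemma cmodN z : cmod (- z) = cmod z.
Proof. by case: z => a b; rewrite /cmod /= !sqrrN. Qed.

Lemma ler_cmodD z w : cmod (z + w) <= cmod z + cmod w.
Proof. exact: le_normcD. Qed.

Lemma cmodB z w : cmod (z - w) = cmod (w - z).
Proof. by rewrite -cmodN opprB. Qed.

Lemma cmod_real (t : R) : 0 <= t -> cmod t%:C = t.
Proof. by move=> t0; rewrite /cmod /= expr0n /= addr0 sqrtr_sqr ger0_norm. Qed.

Lemma cmodX z k : cmod (z ^+ k) = cmod z ^+ k.
Proof.
elim: k => [|k IH]; last by rewrite !exprS cmodM IH.
by rewrite !expr0; exact: ComplexField.Normc.normc1.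
Qed.

Lemma cmod_prod (I : Type) (r : seq I) (F : I -> R[i]) :
  cmod (\prod_(i <- r) F i) = \prod_(i <- r) cmod (F i).
Proof.
elim: r => [|i r IH]; last by rewrite !big_cons cmodM IH.
by rewrite !big_nil; exact: ComplexField.Normc.normc1.
Qed.

Lemma ler_cmod_sum (I : Type) (r : seq I) (P : pred I) (F : I -> R[i]) :
  cmod (\sum_(i <- r | P i) F i) <= \sum_(i <- r | P i) cmod (F i).
Proof.
elim/big_rec2: _ => [|i b z _ IH]; first by rewrite cmod0.
by apply: le_trans (ler_cmodD _ _) _; rewrite lerD2l.
Qed.

Lemma cmod_norm z : `|z| = (cmod z)%:C.
Proof. by case: z. Qed.

Lemma cmod_continuous : continuous (fun z : R[i]^o => cmod z).
Proof.
move=> z; apply/(@cvgrPdist_lt _ R^o _ (nbhs (z : R[i]^o))) => e e0.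
have : \forall w \near (z : R[i]^o), cmod (z - w) < e.
  apply/nbhs_ballP; exists e%:C; first by rewrite /= ltcR.
  by move=> w; rewrite -ball_normE /= cmod_norm ltcR.
apply: filterS => w /=.
(* Reverse triangle inequality. *)
apply: le_lt_trans; rewrite ler_norml lerBlDr lerNl opprB lerBlDr.
apply/andP; split.
  by rewrite cmodB addrC -{1}(subrK z w) addrC ler_cmodD.
by rewrite -{1}(subrK w z) ler_cmodD.
Qed.

End Modulus.

(** * Rays, compact sets and Lipschitz maps *)

Lemma compact_coord_bounded (R : realType) (n : nat) (K : set (Cn R n))
    (i : 'I_n) : compact K -> exists M, forall x, K x -> cmod (x ord0 i) <= M.
Proof.
move=> cK.
have cont : continuous (fun x : Cn R n => cmod (x ord0 i)).
  move=> x; apply: (@continuous_comp _ _ _ (fun x : Cn R n => x ord0 i)).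
    exact: coord_continuous.
  exact: cmod_continuous.
have /compact_bounded[M [_ bM]] :=
  continuous_compact (continuous_subspaceT cont) cK.
exists (M + 1) => x Kx; apply: le_trans (ler_norm _) _.
by apply: (bM (M + 1)); [rewrite ltrDl | exists x].
Qed.

(** A coordinate where [v] is nonzero is bounded on [K] but unbounded along the ray. *)
Lemma ray_escapes_compact (R : realType) (n : nat) (K : set (Cn R n))
    (v : Cn R n) : compact K -> v != 0 ->
  exists T : R, forall t, T <= t -> (~` K) (t%:C *: v).
Proof.
move=> cK v0.
have [i vi] : exists i, v ord0 i != 0.
  apply: contrapT => /forallNP vall; case/eqP: v0; apply/rowP => i.
  by rewrite mxE; apply/eqP; have /negP := vall i; rewrite negbK.
have [M bM] := compact_coord_bounded i cK.
have vp : 0 < cmod (v ord0 i) by rewrite lt_def cmod_ge0 cmod_eq0 vi.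
(* The absolute value forces [0 <= t]; the [+ 1] makes the bound [M] strictly exceeded. *)
exists (`|M| / cmod (v ord0 i) + 1) => t tT /bM.
have t0 : 0 <= t.
  by apply: le_trans tT; rewrite addr_ge0 // divr_ge0 // cmod_ge0.
rewrite mxE cmodM cmod_real // => tM.
have := ler_norm M; rewrite leNgt => /negP; apply; apply: lt_le_trans tM.
by rewrite -ltr_pdivrMr // (lt_le_trans _ tT) // ltrDl.
Qed.

Lemma cmod_le_enorm (R : realType) (n : nat) (x : Cn R n) (i : 'I_n) :
  cmod (x ord0 i) <= enorm x.
Proof.
rewrite -[leLHS]ger0_norm ?cmod_ge0 // -sqrtr_sqr ler_wsqrtr //.
by rewrite (bigD1 i) //= lerDl sumr_ge0 // => j _; rewrite sqr_ge0.
Qed.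

Lemma enormZ (R : realType) (n : nat) (t : R) (x : Cn R n) :
  0 <= t -> enorm (t%:C *: x) = t * enorm x.
Proof.
move=> t0; rewrite /enorm -{2}(ger0_norm t0) -sqrtr_sqr -sqrtrM ?sqr_ge0 //.
rewrite mulr_sumr; congr Num.sqrt; apply: eq_bigr => i _.
by rewrite mxE cmodM cmod_real // exprMn.
Qed.

Lemma enorm_ge0 (R : realType) (n : nat) (x : Cn R n) : 0 <= enorm x.
Proof. exact: sqrtr_ge0. Qed.

(** The distance from [phi (t v)] to the fixed point [phi (T v)] grows at most linearly, and
    [1 <= t] absorbs the constant term. *)
Lemma lipschitz_ray_growth (R : realType) (n : nat) (A : set (Cn R n))
    (phi : Cn R n -> Cn R n) (v : Cn R n) (T : R) :
    1 <= T -> lipschitz_in A phi -> (forall t, T <= t -> A (t%:C *: v)) ->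
  exists2 B, 1 <= B & forall t i, T <= t ->
    cmod (phi (t%:C *: v) ord0 i) <= B * t.
Proof.
move=> T1 [L lip] Aray; set x0 := phi (T%:C *: v).
(* The summand 1 ensures [1 <= B], which [meval_growth] requires. *)
exists (1 + enorm x0 + `|L| * enorm v).
  by rewrite -addrA lerDl addr_ge0 ?mulr_ge0 ?enorm_ge0.
move=> t i tT; have t1 := le_trans T1 tT; have t0 := le_trans ler01 t1.
have Tt : 0 <= t - T by rewrite subr_ge0.
set y := phi _.
have yE : y ord0 i = x0 ord0 i + (y - x0) ord0 i.
  by rewrite [(y - x0) _ _]mxE [(- x0) _ _]mxE addrCA subrr addr0.
rewrite yE (le_trans (ler_cmodD _ _)) //.
have hx0 : cmod (x0 ord0 i) <= enorm x0 * t.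
  by rewrite (le_trans (cmod_le_enorm _ _)) // ler_peMr // enorm_ge0.
have hy : cmod ((y - x0) ord0 i) <= `|L| * enorm v * t.
  rewrite (le_trans (cmod_le_enorm _ _)) // (le_trans (lip _ _ _ _)) //.
  - exact: Aray.
  - exact: Aray.
  rewrite -scalerBl -rmorphB /= enormZ // mulrA mulrAC.
  apply: (@le_trans _ _ (`|L| * enorm v * (t - T))).
    by rewrite ler_wpM2r // ler_wpM2r ?enorm_ge0 // ler_norm.
  by rewrite ler_wpM2l ?mulr_ge0 ?enorm_ge0 // gerBl (le_trans ler01 T1).
by rewrite !mulrDl mul1r -addrA (le_trans (lerD hx0 hy)) // lerDr.
Qed.

(** * Growth of polynomials at infinity *)

(* The extra factor t turns the degree into msize, which makes the bound valid
   for g = 0 as well. *)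
Lemma meval_growth (R : realType) (n : nat) (g : mpoly.mpoly n R[i]) (B : R) :
  1 <= B -> exists2 M, 0 <= M & forall (t : R) (y : 'I_n -> R[i]), 1 <= t ->
    (forall i, cmod (y i) <= B * t) ->
    t * cmod (mpoly.meval y g) <= M * t ^+ mpoly.msize g.
Proof.
move=> B1; have B0 := le_trans ler01 B1.
exists ((\sum_(m <- mpoly.msupp g) cmod (mpoly.mcoeff m g))
        * B ^+ mpoly.msize g).
  by rewrite mulr_ge0 ?exprn_ge0 // sumr_ge0 // => m _; exact: cmod_ge0.
move=> t y t1 yB; have t0 := le_trans ler01 t1.
have Bt1 : 1 <= B * t by rewrite mulr_ege1.
rewrite -mulrA -exprMn mpoly.mevalE.
apply: (@le_trans _ _ (t * \sum_(m <- mpoly.msupp g)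
    cmod (mpoly.mcoeff m g) * \prod_(i < n) cmod (y i) ^+ m i)).
  rewrite ler_wpM2l // (le_trans (ler_cmod_sum _ _ _)) //.
  apply: ler_sum => m _; rewrite cmodM cmod_prod.
  by under eq_bigr do rewrite cmodX.
rewrite mulr_sumr mulr_suml big_seq [leRHS]big_seq.
apply: ler_sum => m mg; rewrite mulrCA ler_wpM2l ?cmod_ge0 //.
(* The extra factor [t], at most [B * t], raises the exponent by one; it stays within [msize g]
   since [m] is in the support. *)
apply: (@le_trans _ _ ((B * t) ^+ (mpoly.mdeg m).+1)); last first.
  by rewrite ler_weXn2l // mpoly.msize_mdeg_lt.
rewrite exprS ler_pM ?prodr_ge0 // => [||].
- by move=> i _; rewrite exprn_ge0 ?cmod_ge0.
- by rewrite ler_peMl.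
rewrite mpoly.mdegE -prodrXr; apply: ler_prod => i _.
by rewrite exprn_ge0 ?cmod_ge0 // lerXn2r ?nnegrE ?cmod_ge0 // (le_trans ler01).
Qed.

Lemma meval_pihomog (F : comNzRingType) (n d : nat) (p : mpoly.mpoly n F) v :
  mpoly.meval v (mpoly.pihomog mpoly.mdeg d p) =
  \sum_(m <- mpoly.msupp p | mpoly.mdeg m == d)
    mpoly.mcoeff m p * \prod_(i < n) v i ^+ m i.
Proof.
rewrite mpoly.pihomogE rmorph_sum /=; apply: eq_bigr => m _.
by rewrite mpoly.mevalZ mpoly.mevalX.
Qed.

(** The leading monomial has top degree, so it survives with its nonzero coefficient. *)
Lemma pihomog_top_neq0 (F : nzRingType) (n : nat) (p : mpoly.mpoly n F) :
  p != 0 -> mpoly.pihomog mpoly.mdeg (mpoly.msize p).-1 p != 0.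
Proof.
move=> p0; have m0p := mpoly.mlead_supp p0.
apply/eqP => /(congr1 (mpoly.mcoeff (mpoly.mlead p))).
rewrite mpoly.pihomogE raddf_sum /= mpoly.mcoeff0 -(mpoly.mlead_deg p0) /=.
rewrite big_mkcond (bigD1_seq (mpoly.mlead p)) ?mpoly.msupp_uniq //= eqxx.
rewrite mpoly.mcoeffZ mpoly.mcoeffX eqxx mulr1 big1 ?addr0 => [|m mp].
  by apply/eqP; rewrite -mpoly.mcoeff_msupp.
by case: ifP => // _; rewrite mpoly.mcoeffZ mpoly.mcoeffX (negbTE mp) mulr0.
Qed.

(** On the ray the leading form scales exactly by the top power of [t], while all other monomials
    have lower degree and go into the error term. *)
Lemma meval_ray_lower (R : realType) (n : nat) (f : mpoly.mpoly n R[i])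
    (v : 'I_n -> R[i]) : f != 0 ->
  exists2 S, 0 <= S & forall t : R, 1 <= t ->
    cmod (mpoly.meval v (mpoly.pihomog mpoly.mdeg (mpoly.msize f).-1 f))
      * t ^+ mpoly.msize f <=
    t * cmod (mpoly.meval (fun i => t%:C * v i) f)
      + S * t ^+ (mpoly.msize f).-1.
Proof.
move=> f0; set e := (mpoly.msize f).-1.
have fE : mpoly.msize f = e.+1 by rewrite /e -(mpoly.mlead_deg f0).
pose c m := mpoly.mcoeff m f * \prod_(i < n) v i ^+ m i.
exists (\sum_(m <- mpoly.msupp f) cmod (c m)).
  by apply: sumr_ge0 => m _; exact: cmod_ge0.
move=> t t1; have t0 := le_trans ler01 t1.
have -> : mpoly.meval (fun i => t%:C * v i) f =
    \sum_(m <- mpoly.msupp f) t%:C ^+ mpoly.mdeg m * c m.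
  rewrite mpoly.mevalE; apply: eq_bigr => m _; rewrite /c mulrCA.
  congr (_ * _); rewrite mpoly.mdegE -prodrXr -big_split /=.
  by apply: eq_bigr => i _; rewrite exprMn.
rewrite (bigID (fun m => mpoly.mdeg m == e)) /=.
set top := \sum_(m <- _ | mpoly.mdeg m == e) _.
set rest := \sum_(m <- _ | mpoly.mdeg m != e) _.
have -> : cmod (mpoly.meval v (mpoly.pihomog mpoly.mdeg e f)) *
    t ^+ mpoly.msize f = t * cmod top.
  rewrite fE exprS mulrCA; congr (_ * _).
  rewrite -[X in X ^+ e](cmod_real t0) -cmodX -cmodM meval_pihomog; congr cmod.
  by rewrite mulrC mulr_sumr; apply: eq_bigr => m /eqP ->.
have rest_le : t * cmod rest <= (\sum_(m <- mpoly.msupp f) cmod (c m)) * t ^+ e.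
  apply: (@le_trans _ _ (t * \sum_(m <- mpoly.msupp f | mpoly.mdeg m != e)
      t ^+ mpoly.mdeg m * cmod (c m))).
    rewrite ler_wpM2l // (le_trans (ler_cmod_sum _ _ _)) //.
    by apply: ler_sum => m _; rewrite cmodM cmodX cmod_real.
  rewrite mulr_sumr mulr_suml big_seq_cond big_mkcond.
  rewrite [leRHS]big_seq_cond [leRHS]big_mkcond; apply: ler_sum => m _.
  case: (boolP (m \in _)) => //= mf.
  case: ifPn => me; last by rewrite mulr_ge0 ?exprn_ge0 ?cmod_ge0.
  (* The degree of [m] is below [e], which leaves room for the factor [t]. *)
  rewrite mulrA -exprS mulrC ler_wpM2l ?cmod_ge0 // ler_weXn2l //.
  by rewrite ltn_neqAle me -ltnS -fE mpoly.msize_mdeg_lt.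
apply: le_trans (lerD (lexx _) rest_le).
(* Triangle inequality for [top = (top + rest) - rest]. *)
rewrite -mulrDr ler_wpM2l // -{1}(addrK rest top).
by rewrite (le_trans (ler_cmodD _ _)) // cmodN.
Qed.

(** * Comparison of degrees *)

(** The one-sided form serves both for [phi] and for its inverse. *)
Lemma msize_le_of_contact (R : realType) (n : nat) (K : set (Cn R n))
    (phi : Cn R n -> Cn R n) (C : R) (f g : mpoly.mpoly n R[i]) :
    (1 <= n)%N -> compact K -> lipschitz_in (~` K) phi ->
    (forall x, (~` K) x -> cmod (peval f x) <= C * cmod (peval g (phi x))) ->
  (mpoly.msize f <= mpoly.msize g)%N.
Proof.
move=> n0 cK lip fg; rewrite leqNgt; apply/negP => gf.
have f0 : f != 0 by apply: contraTneq gf => ->; rewrite mpoly.msize0.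
pose top := mpoly.pihomog mpoly.mdeg (mpoly.msize f).-1 f.
(* The factor X_0 only serves to make the direction w nonzero. *)
have [w] : exists w,
    mpoly.meval w (top * mpoly.mpolyX _ (mpoly.mnm1 (Ordinal n0))) != 0.
  apply: mpoly_exists_nonzero_eval; apply: mulf_neq0.
    exact: pihomog_top_neq0.
  by rewrite -mpoly.msize_poly_eq0 mpoly.msizeX.
rewrite mpoly.mevalM mpoly.mevalXU mulf_eq0 negb_or => /andP[topw w0].
pose v : Cn R n := \row_i w i.
have v0 : v != 0.
  by apply: contraNneq w0 => /rowP/(_ (Ordinal n0)); rewrite !mxE => ->.
have [T0 esc] := ray_escapes_compact cK v0.
pose T := Num.max 1 T0.
have T1 : 1 <= T by rewrite le_max lexx.
have escT t : T <= t -> (~` K) (t%:C *: v).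
  by rewrite ge_max => /andP[_ /esc].
have [B B1 phiB] := lipschitz_ray_growth T1 lip escT.
have [M M0 gM] := meval_growth g B1.
have [S S0 fS] := meval_ray_lower w f0.
set c := cmod _ in fS.
have c0 : 0 < c by rewrite lt_def cmod_ge0 cmod_eq0 topw.
(* Since [msize g <= (msize f).-1], the upper bound for [g] and the error term for [f] are both
   multiples of [t ^+ (msize f).-1], which is divided out. *)
have bound t : T <= t -> c * t <= `|C| * M + S.
  move=> tT; have t1 := le_trans T1 tT; have tp := lt_le_trans ltr01 t1.
  have e1 : mpoly.msize f = (mpoly.msize f).-1.+1.
    by rewrite prednK // (leq_trans _ gf).
  rewrite -(ler_pM2r (exprn_gt0 (mpoly.msize f).-1 tp)) -mulrA -exprS -e1.
  rewrite (le_trans (fS t t1)) // mulrDl lerD2r.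
  have -> : mpoly.meval (fun i => t%:C * w i) f = peval f (t%:C *: v).
    by apply: mpoly.meval_eq => i; rewrite !mxE.
  apply: (@le_trans _ _ (t * (`|C| * cmod (peval g (phi (t%:C *: v)))))).
    rewrite ler_wpM2l ?(ltW tp) // (le_trans (fg _ (escT _ tT))) //.
    by rewrite ler_wpM2r ?cmod_ge0 // ler_norm.
  rewrite mulrCA -mulrA ler_wpM2l //.
  apply: (le_trans (gM t _ t1 _)) => [i|]; first exact: phiB.
  by rewrite ler_wpM2l // ler_weXn2l // -ltnS -e1.
(* A parameter beyond [T] at which [c * t] exceeds its alleged bound. *)
have := bound (Num.max T ((`|C| * M + S) / c + 1)).
rewrite le_max lexx => /(_ isT); apply/negP; rewrite -ltNge.
rewrite -ltr_pdivrMl // lt_max; apply/orP; right.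
by rewrite mulrC ltrDl.
Qed.

Theorem theorem3p7 (R : realType) (n : nat) (hn : (1 <= n)%N)
    (f g : mpoly.mpoly n R[i]) :
  bilipschitz_contact_equiv_infty f g -> total_degree f = total_degree g.
Proof.
case=> K [K' [C [phi [cK cK' C0 [[img _ surj] lip [psi [psiK lipsi]]] fg]]]].
rewrite /total_degree; suff -> : mpoly.msize f = mpoly.msize g by [].
apply/eqP; rewrite eqn_leq; apply/andP; split.
  apply: (@msize_le_of_contact R n K phi C) => // x Kx.
  by have /andP[] := fg x Kx; rewrite ler_pdivrMl.
(* At [y = phi x] the upper contact bound reads [|g y| <= C |f (psi y)|]; surjectivity covers all
   [y] outside [K']. *)
apply: (@msize_le_of_contact R n K' psi C) => // y /surj[x Kx <-].
by rewrite psiK //; have /andP[] := fg x Kx.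
Qed.
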